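(* Let $\mathbf A\in\mathbb C^{n\times n}$ and $\mathbf B\in\mathbb C^{m\times m}$ be diagonalizable, let $\mathbf C\in\mathbb C^{m\times n}$, and let $\mathcal S_{\mathbf A,\mathbf B}:\mathbb C^{m\times n}\to\mathbb C^{m\times n}$ be the Sylvester operator $\mathcal S_{\mathbf A,\mathbf B}\mathbf Y=\mathbf Y\mathbf A-\mathbf B\mathbf Y$. Assume that the spectrum $\sigma(\mathcal S_{\mathbf A,\mathbf B})$ is contained in the interior of $\Sigma=\bigcup_{j=1}^{g+1}[\beta_j,\gamma_j]\subset\mathbb R$, a finite union of disjoint intervals ($\beta_j<\gamma_j$) with $0\notin\Sigma$. Let $w$ be an admissible weight function on $\Sigma$ (see context), with orthonormal polynomials $(p_j)_{j=0}^\infty$ and recurrence coefficients $(a_j,b_j)_{j=0}^\infty$. Then the solution $\mathbf X\in\mathbb C^{m\times n}$ of the Sylvester equation $\mathbf X\mathbf A-\mathbf B\mathbf X=\mathbf C$ is given by $$\mathbf X=\sum_{j=0}^\infty\alpha_j\mathbf P_j,\qquad \alpha_j=2\pi i\,\mathcal C_\Sigma[p_jw](0),$$ where the matrices $\mathbf P_j\in\mathbb C^{m\times n}$ are given by the recurrence $$\mathbf P_0=\mathbf C,\qquad \mathbf P_1=\frac1{b_0}\bigl(\mathbf P_0\mathbf A-\mathbf B\mathbf P_0-a_0\mathbf P_0\bigr),$$ $$\mathbf P_j=\frac1{b_{j-1}}\bigl(\mathbf P_{j-1}\mathbf A-\mathbf B\mathbf P_{j-1}-a_{j-1}\mathbf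 P_{j-1}-b_{j-2}\mathbf P_{j-2}\bigr),\quad j\ge2.$$
   Context: Admissible weight function: a nonnegative function $w$ supported on $\Sigma$, continuous and positive on the interior of $\Sigma$, normalized by $\int_\Sigma w(x)\,dx=1$, of the form $$w(x)=\sum_{j=1}^{g+1}\mathbf 1_{[\beta_j,\gamma_j]}(x)\,h_j(x)\left(\sqrt{x-\beta_j}\right)^{c_j}\left(\sqrt{\gamma_j-x}\right)^{d_j},\qquad c_j,d_j\in\{-1,1\},$$ where each $h_j$ is positive on $[\beta_j,\gamma_j]$ and has an analytic extension to a neighborhood of $[\beta_j,\gamma_j]$. The orthonormal polynomials $(p_j)_{j\ge0}$ for $w$ are the polynomials with $\deg p_j=j$ and positive leading coefficient satisfying $\int_\Sigma p_j(x)p_k(x)w(x)\,dx=\delta_{jk}$. Their recurrence coefficients $a_j\in\mathbb R$, $b_j>0$ are defined by $xp_0(x)=a_0p_0(x)+b_0p_1(x)$ and $xp_k(x)=b_{k-1}p_{k-1}(x)+a_kp_k(x)+b_kp_{k+1}(x)$ for $k\ge1$. The Cauchy transform is $\mathcal C_\Sigma f(z)=\frac1{2\pi i}\int_\Sigma\frac{f(s)}{s-z}\,ds$ for $z\in\mathbb C\setminus\Sigma$, so that $2\pi i\,\mathcal C_\Sigma[p_jw](0)=\int_\Sigma\frac{p_j(x)w(x)}{x}\,dx$. *)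

(* Defs.v *)
From HB Require Import structures.
From mathcomp Require Import all_boot all_order all_algebra.
From mathcomp Require Import complex.
From mathcomp Require Import all_classical all_reals all_analysis.

Set Implicit Arguments.
Unset Strict Implicit.
Unset Printing Implicit Defensive.

Import Order.TTheory GRing.Theory Num.Theory.
Import numFieldNormedType.Exports.

Local Open Scope classical_set_scope.
Local Open Scope ring_scope.
Local Open Scope complex_scope.

Section Sylvester.
Context {F : fieldType} {m n : nat}.

Definition sylvester (A : 'M[F]_n) (B : 'M[F]_m) (Y : 'M[F]_(m, n)) :
  'M[F]_(m, n) := Y *m A - B *m Y.

Fact sylvester_is_linear (A : 'M[F]_n) (B : 'M[F]_m) : linear (sylvester A B).
Proof.
move=> k Y Z; rewrite /sylvester mulmxDl mulmxDr -scalemxAl -scalemxAr.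
by rewrite scalerBr opprD addrACA.
Qed.

HB.instance Definition _ (A : 'M[F]_n) (B : 'M[F]_m) :=
  GRing.isLinear.Build F 'M[F]_(m, n) 'M[F]_(m, n) *:%R (sylvester A B)
    (sylvester_is_linear A B).

(* In finite dimension the spectrum is the set of eigenvalues. [linfun] only
   agrees with its argument when the latter carries a linear structure, which
   the instance above provides for [sylvester A B]. *)
Definition sylvester_spectrum (A : 'M[F]_n) (B : 'M[F]_m) : set F :=
  [set l | passmx.leigenvalue (linfun (sylvester A B)) l].

End Sylvester.

Section Weight.
Context {R : realType}.

Definition interval_union {g : nat} (beta gamma : 'I_g.+1 -> R) : set R :=
  \bigcup_(j in [set: 'I_g.+1]) `[beta j, gamma j]%classic.

(* Complex analyticity is expressed as complex differentiability on an open
   set: [R[i]^o] is R[i] seen as a normed space over itself, so [derivable] is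
   taken with respect to complex increments. *)
Definition analytic_extension (a b : R) (h : R -> R) : Prop :=
  exists (U : set R[i]^o) (H : R[i]^o -> R[i]^o),
    [/\ open U,
        (forall x : R, a <= x <= b -> U x%:C),
        (forall z : R[i]^o, U z -> derivable H z 1) &
        (forall x : R, a <= x <= b -> H x%:C = (h x)%:C)].

(* At an endpoint where the exponent is -1 the formula has a singularity; as
   0^-1 = 0, the weight then vanishes there. This concerns a null set only. *)
Record admissible_weight {g : nat} (beta gamma : 'I_g.+1 -> R)
    (w : R -> R) : Prop := AdmissibleWeight {
  weight_ge0 : forall x, 0 <= w x;
  weight_supp : forall x, ~ interval_union beta gamma x -> w x = 0;
  weight_cont : forall x, interior (interval_union beta gamma) x ->
    {for x, continuous w};
  weight_gt0 : forall x, interior (interval_union beta gamma) x -> 0 < w x;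
  weight_int : \int[lebesgue_measure]_(x in interval_union beta gamma) w x = 1;
  weight_form : exists (h : 'I_g.+1 -> R -> R) (c d : 'I_g.+1 -> int),
    (forall j, [/\ (c j = -1 \/ c j = 1), (d j = -1 \/ d j = 1),
       (forall x, beta j <= x <= gamma j -> 0 < h j x) &
       analytic_extension (beta j) (gamma j) (h j)]) /\
    (forall x, w x = \sum_(j < g.+1)
       \1_(`[beta j, gamma j]%classic) x * h j x
         * Num.sqrt (x - beta j) ^ c j * Num.sqrt (gamma j - x) ^ d j)
}.

Definition orthonormal_polys (S : set R) (w : R -> R) (p : nat -> {poly R}) :
    Prop :=
  (forall j, size (p j) = j.+1 /\ 0 < lead_coef (p j)) /\
  (forall j k, \int[lebesgue_measure]_(x in S) ((p j).[x] * (p k).[x] * w x)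
     = (j == k)%:R).

Definition recurrence_coefs (p : nat -> {poly R}) (a b : nat -> R) : Prop :=
  [/\ (forall j, 0 < b j),
      'X * p 0%N = a 0%N *: p 0%N + b 0%N *: p 1%N &
      forall k, 'X * p k.+1 =
        b k *: p k + a k.+1 *: p k.+1 + b k.+1 *: p k.+2].

Definition Cintegral (S : set R) (f : R -> R[i]) : R[i] :=
  (\int[lebesgue_measure]_(x in S) complex.Re (f x))
    +i* (\int[lebesgue_measure]_(x in S) complex.Im (f x)).

Definition two_pi_i : R[i] := 2 * pi%:C * 'i.

Definition cauchy_transform (S : set R) (f : R -> R[i]) (z : R[i]) : R[i] :=
  two_pi_i^-1 * Cintegral S (fun s => f s / (s%:C - z)).

Definition series_coef (S : set R) (w : R -> R) (p : nat -> {poly R})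
    (j : nat) : R[i] :=
  two_pi_i * cauchy_transform S (fun x => ((p j).[x] * w x)%:C) 0.

Definition sylvester_recurrence {m n : nat} (A : 'M[R[i]]_n) (B : 'M[R[i]]_m)
    (C : 'M[R[i]]_(m, n)) (a b : nat -> R) (P : nat -> 'M[R[i]]_(m, n)) : Prop :=
  [/\ P 0%N = C,
      P 1%N = ((b 0%N)%:C)^-1 *:
        (P 0%N *m A - B *m P 0%N - (a 0%N)%:C *: P 0%N) &
      forall j, P j.+2 = ((b j.+1)%:C)^-1 *:
        (P j.+1 *m A - B *m P j.+1 - (a j.+1)%:C *: P j.+1
           - (b j)%:C *: P j)].

End Weight.

(* Main.v *)
Require Import Defs.
From mathcomp Require Import all_boot all_order all_algebra.
From mathcomp Require Import complex ring lra.
From mathcomp Require Import all_classical all_reals all_analysis.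
From mathcomp Require Import measurable_realfun.

Set Implicit Arguments.
Unset Strict Implicit.
Unset Printing Implicit Defensive.

Import Order.TTheory GRing.Theory Num.Theory.
Import numFieldNormedType.Exports.

Local Open Scope classical_set_scope.
Local Open Scope ring_scope.
Local Open Scope complex_scope.

(** Eigenvector matrices of A and B turn the operator Y |-> Y A - B Y into the
    multiplication of each entry by an eigenvalue, and the recurrence of the
    matrices P_j into the three-term recurrence of the polynomials p_j; the
    transformed P_j therefore has the entries p_j(lambda) c, where lambda is the
    eigenvalue and c the entry of the transformed right-hand side
    ([sylvester_recurrence_horner]). What remains is a scalar fact: for lambda
    in the interior of Sigma, the expansion of 1/x in the polynomials p_j, whose
    coefficients are alpha_j = int p_j(x) w(x) / x dx, converges at lambda to
    1/lambda ([fourier_inv_cvg]).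

    Pointwise convergence results from geometric decay beating polynomial
    growth. On one side, 1/x is approximated on Sigma by polynomials of degree
    below N up to c rho^N with rho < 1 ([inv_poly_approx]): although 0 may lie
    in a gap of Sigma, x^2 ranges over a compact part of the positive half-line,
    so that 1/x = x (1/x^2) can be expanded in a geometric series in x^2. The
    partial sums of order N of the expansion reproduce the polynomials of degree
    below N ([orthonormal_polys_expand]), and each coefficient of a function
    bounded by E is at most E ([fourier_coef_norm_le]); hence the error at
    lambda is at most c rho^N (1 + sum_(j < N) |p_j(lambda)|).

    On the other side, p_j(lambda)^2 = O(j) ([orthonormal_poly_value_le]). As w
    is bounded below on some [lambda - d, lambda + d], the integral of p_j^2
    over this interval is bounded, and a polynomial q with N coefficients
    satisfies q(lambda)^2 = O(N) times the integral of q^2 over the interval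
    ([sqr_horner_center_le]). To see the latter, put x = lambda + d cos t: the
    function q(lambda + d cos t) sin t is a combination of sin t, ..., sin (N t),
    and its value at t = pi / 2 is controlled by its L^2 norm through the
    orthogonality of the sines and the Cauchy-Schwarz inequality. *)

(** * The value of a polynomial at the centre of an interval *)

Lemma sqr_sum_le (R : realFieldType) (N : nat) (u : 'I_N -> R) :
  (\sum_k u k) ^+ 2 <= N%:R * \sum_k u k ^+ 2.
Proof.
rewrite expr2 mulr_suml.
have h (k : 'I_N) : u k * \sum_l u l <= \sum_l (u k ^+ 2 + u l ^+ 2) / 2.
  rewrite mulr_sumr; apply: ler_sum => l _.
  by have := sqr_ge0 (u k - u l); nra.
apply: (le_trans (ler_sum _ (fun k _ => h k))).
rewrite le_eqVlt; apply/orP; left; apply/eqP.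
transitivity (\sum_(k < N) (N%:R * u k ^+ 2 + \sum_l u l ^+ 2) / 2).
  apply: eq_bigr => k _.
  by rewrite -mulr_suml big_split /= sumr_const card_ord mulr_natl.
rewrite -mulr_suml big_split /= -mulr_sumr sumr_const card_ord -mulr_natl.
by field.
Qed.

Section SinePolynomials.
Variable R : realType.
Implicit Types (F : R -> R) (q Q : {poly R}).

(** Multiplying by sin t makes q(x + d cos t) an odd trigonometric polynomial,
    so that no cosine is needed, and provides at the same time the weight
    sin^2 t <= sin t that compares with the Jacobian of the substitution. *)
Definition sine_poly (N : nat) F : Prop :=
  exists c : nat -> R, forall t, F t = \sum_(k < N) c k * sin (k.+1%:R * t).

Lemma eq_sine_poly N F1 F2 : F1 =1 F2 -> sine_poly N F1 -> sine_poly N F2.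
Proof. by move=> /funext ->. Qed.

Lemma sine_poly0 N : sine_poly N (fun=> 0).
Proof. by exists (fun=> 0) => t; rewrite big1// => k _; rewrite mul0r. Qed.

Lemma sine_polyD N F1 F2 :
  sine_poly N F1 -> sine_poly N F2 -> sine_poly N (fun t => F1 t + F2 t).
Proof.
move=> [c1 h1] [c2 h2]; exists (fun k => c1 k + c2 k) => t.
by rewrite h1 h2 -big_split; apply: eq_bigr => k _; rewrite mulrDl.
Qed.

Lemma sine_polyZ N a F : sine_poly N F -> sine_poly N (fun t => a * F t).
Proof.
move=> [c h]; exists (fun k => a * c k) => t.
by rewrite h mulr_sumr; apply: eq_bigr => k _; rewrite mulrA.
Qed.

Lemma sine_poly_sum N M (G : nat -> R -> R) :
  (forall k, (k < M)%N -> sine_poly N (G k)) ->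
  sine_poly N (fun t => \sum_(k < M) G k t).
Proof.
elim: M => [|M IH] h.
  by apply: eq_sine_poly (sine_poly0 N) => t; rewrite big_ord0.
have h1 : sine_poly N (fun t => \sum_(k < M) G k t).
  by apply: IH => k kM; apply: h; exact: ltnW.
apply: eq_sine_poly (sine_polyD h1 (h M (ltnSn M))) => t.
by rewrite big_ord_recr.
Qed.

Lemma sine_poly_sin N k : (k <= N)%N -> sine_poly N (fun t => sin (k%:R * t)).
Proof.
case: k => [_|k kN].
  by apply: eq_sine_poly (sine_poly0 N) => t; rewrite mul0r sin0.
exists (fun j => (j == k)%:R) => t.
rewrite (bigD1 (Ordinal kN)) //= eqxx mul1r big1 ?addr0// => j.
by rewrite -val_eqE/= => /negbTE ->; rewrite mul0r.
Qed.

Lemma sine_polyS N F : sine_poly N F -> sine_poly N.+1 F.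
Proof.
move=> [c h].
apply: (@eq_sine_poly _ (fun t => \sum_(k < N) c k * sin (k.+1%:R * t))).
  by move=> t; rewrite h.
apply: (sine_poly_sum (G := fun k t => c k * sin (k.+1%:R * t))) => k kN.
by apply: sine_polyZ; apply: sine_poly_sin; exact: ltnW.
Qed.

(** 2 cos t sin (k t) = sin ((k + 1) t) + sin ((k - 1) t). *)
Lemma sine_poly_cosM N F :
  sine_poly N F -> sine_poly N.+1 (fun t => cos t * F t).
Proof.
move=> [c h].
apply: (@eq_sine_poly _ (fun t => \sum_(k < N)
    c k / 2 * (sin (k.+2%:R * t) + sin (k%:R * t)))).
  move=> t; rewrite h mulr_sumr; apply: eq_bigr => k _.
  have -> : k.+2%:R * t = k.+1%:R * t + t by rewrite -natr1 mulrDl mul1r.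
  have -> : sin (k%:R * t) = sin (k.+1%:R * t - t).
    by congr sin; rewrite -natr1 mulrDl mul1r addrK.
  by rewrite sinD sinB; field.
apply: (sine_poly_sum (G := fun k t =>
  c k / 2 * (sin (k.+2%:R * t) + sin (k%:R * t)))).
move=> k kN; apply: sine_polyZ; apply: sine_polyD; apply: sine_poly_sin => //.
by rewrite ltnW// ltnW.
Qed.

Lemma sine_poly_horner N q (x d : R) : (size q <= N)%N ->
  sine_poly N (fun t => q.[x + d * cos t] * sin t).
Proof.
elim/poly_ind: q N => [|q a IH] [|N].
- by move=> _; apply: eq_sine_poly (sine_poly0 _) => t; rewrite horner0 mul0r.
- by move=> _; apply: eq_sine_poly (sine_poly0 _) => t; rewrite horner0 mul0r.
- rewrite leqn0 size_poly_eq0 => /eqP ->.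
  by apply: eq_sine_poly (sine_poly0 _) => t; rewrite horner0 mul0r.
rewrite size_MXaddC => sz; have sq : (size q <= N)%N.
  by move: sz; case: ifP => [/andP[/eqP-> _]|]; rewrite ?size_poly0.
have hx := sine_polyZ x (sine_polyS (IH _ sq)).
have hd := sine_polyZ d (sine_poly_cosM (IH _ sq)).
have ha := sine_polyZ a (@sine_poly_sin N.+1 1 isT).
apply: eq_sine_poly (sine_polyD (sine_polyD hx hd) ha) => t.
by rewrite hornerD hornerMX hornerC mul1r; ring.
Qed.

Lemma sin_natMpi k : sin (k%:R * pi) = 0 :> R.
Proof.
elim: k => [|k IH]; first by rewrite mul0r sin0.
by rewrite -natr1 mulrDl mul1r sinDpi IH oppr0.
Qed.

Lemma is_deriveMl (a t df : R) F :
  is_derive t 1 F df -> is_derive t 1 (fun t => a * F t) (a * df).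
Proof. by move=> h; exact: (@is_deriveZ R R R F a t 1 df h). Qed.

Lemma is_derive_sinM (a t : R) :
  is_derive t 1 (fun t => sin (a * t)) (a * cos (a * t)).
Proof.
have h : is_derive t 1 (fun t : R => a * t) (a * 1).
  by apply: is_deriveMl; exact: is_derive_id.
have := @is_derive1_comp R sin (fun t => a * t) t _ _ (is_derive_sin _) h.
by rewrite mulr1 mulrC.
Qed.

(** For k, l > 0 this is an antiderivative of sin (k t) sin (l t). With it, the
    square of a sine polynomial has an explicit antiderivative, and Parseval's
    identity on [0, pi] is read off at the two ends. *)
Definition sine_prod_prim (k l : nat) (t : R) : R :=
  (if k == l then 2^-1 * t
   else (2 * (k%:R - l%:R))^-1 * sin ((k%:R - l%:R) * t))
  - (2 * (k%:R + l%:R))^-1 * sin ((k%:R + l%:R) * t).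

Lemma is_derive_sine_prod_prim k l (t : R) :
  is_derive t 1 (sine_prod_prim k.+1 l.+1)
    (sin (k.+1%:R * t) * sin (l.+1%:R * t)).
Proof.
have D1 (a : R) : a != 0 ->
    is_derive t 1 (fun t => (2 * a)^-1 * sin (a * t)) (2^-1 * cos (a * t)).
  move=> a0; have := is_deriveMl (2 * a)^-1 (is_derive_sinM a t).
  by rewrite mulrA invfM -(mulrA 2^-1) mulVf// mulr1.
have pos : k.+1%:R + l.+1%:R != 0 :> R by rewrite -natrD pnatr_eq0.
rewrite /sine_prod_prim; have [->|kl] := eqVneq k.+1 l.+1.
  have h1 : is_derive t 1 (fun t : R => 2^-1 * t) (2^-1 * 1).
    by apply: is_deriveMl; exact: is_derive_id.
  have pos2 : l.+1%:R + l.+1%:R != 0 :> R by rewrite -natrD pnatr_eq0.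
  have h := @is_deriveB _ _ _ _ _ t 1 _ _ h1 (D1 _ pos2).
  apply: is_derive_eq h _; rewrite [(_ + _) * t]mulrDl cosD.
  by have := cos2Dsin2 (l.+1%:R * t); lra.
have kl0 : k.+1%:R - l.+1%:R != 0 :> R by rewrite subr_eq0 eqr_nat.
have h := @is_deriveB _ _ _ _ _ t 1 _ _ (D1 _ kl0) (D1 _ pos).
apply: is_derive_eq h _.
by rewrite [(_ - _) * t]mulrBl [(_ + _) * t]mulrDl cosB cosD; field.
Qed.

Lemma sine_prod_prim0 k l : sine_prod_prim k l 0 = 0.
Proof. by rewrite /sine_prod_prim !mulr0 sin0 !mulr0 if_same subr0. Qed.

Lemma sine_prod_primpi k l : sine_prod_prim k l pi = (k == l)%:R * (pi / 2).
Proof.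
rewrite /sine_prod_prim [(_ - _) * pi]mulrBl [(_ + _) * pi]mulrDl sinB sinD.
rewrite !sin_natMpi !(mulr0, mul0r, addr0, subr0).
by case: ifP; rewrite ?mul1r ?mul0r// mulrC.
Qed.

(** G pi - G 0 is the integral of F^2 over [0, pi], that is pi / 2 times the sum
    of the squares of the N coefficients; F (pi / 2) is a sum of N terms bounded
    by these coefficients. *)
Lemma sine_poly_sqr_pihalf_le N F : sine_poly N F ->
  exists G : R -> R, (forall t : R, is_derive t 1 G (F t ^+ 2)) /\
    (pi / 2) * F (pi / 2) ^+ 2 <= N%:R * (G pi - G 0).
Proof.
move=> [c h].
pose G t := \sum_(k < N) \sum_(l < N) c k * c l * sine_prod_prim k.+1 l.+1 t.
have GE : G = \sum_(k < N) \sum_(l < N)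
    (fun t => c k * c l * sine_prod_prim k.+1 l.+1 t).
  apply/funext => t; rewrite fct_sumE; apply: eq_bigr => k _.
  by rewrite fct_sumE.
exists G; split.
  move=> t; rewrite h expr2 mulr_suml GE.
  have D (k l : 'I_N) : is_derive t 1
      (fun t => c k * c l * sine_prod_prim k.+1 l.+1 t)
      (c k * c l * (sin (k.+1%:R * t) * sin (l.+1%:R * t))).
    by apply: is_deriveMl; exact: is_derive_sine_prod_prim.
  apply: is_derive_eq.
  apply: eq_bigr => k _; rewrite mulr_sumr; apply: eq_bigr => l _.
  ring.
have -> : G 0 = 0.
  by rewrite /G big1// => k _; rewrite big1// => l _; rewrite sine_prod_prim0 mulr0.
have -> : G pi = pi / 2 * \sum_(k < N) c k ^+ 2.
  rewrite /G mulr_sumr; apply: eq_bigr => k _.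
  rewrite (bigD1 k)//= big1 ?addr0 => [|l lk].
    by rewrite sine_prod_primpi eqxx mul1r; ring.
  by rewrite sine_prod_primpi eqSS eq_sym val_eqE (negbTE lk) mul0r mulr0.
rewrite subr0 [leRHS]mulrCA ler_pM2l ?divr_gt0 ?pi_gt0// h.
apply: (le_trans (sqr_sum_le _)).
apply: ler_wpM2l => //; apply: ler_sum => k _.
by rewrite exprMn ler_piMr ?sqr_ge0.
Qed.

(** Q (x + d) - Q (x - d) stands for the integral of q^2 over [x - d, x + d].
    After the substitution y = x + d cos t it becomes the integral over [0, pi]
    of d q(y)^2 sin t, which dominates that of d (q(y) sin t)^2. The domination
    is obtained from the monotonicity of the difference of antiderivatives. *)
Lemma sqr_horner_center_le N q Q (x d : R) : 0 < d -> (size q <= N)%N ->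
  Q^`() = q ^+ 2 ->
  pi / 2 * d * q.[x] ^+ 2 <= N%:R * (Q.[x + d] - Q.[x - d]).
Proof.
move=> d0 sq Qq.
have [G [dG hG]] := sine_poly_sqr_pihalf_le (sine_poly_horner x d sq).
move: hG; rewrite sin_pihalf cos_pihalf mulr0 addr0 mulr1 => hG.
pose Phi (t : R) : R := (- d^-1) * Q.[x + d * cos t] - G t.
pose dPhi (t : R) : R := q.[x + d * cos t] ^+ 2 * sin t * (1 - sin t).
have dP (t : R) : is_derive t 1 Phi (dPhi t).
  have h1 : is_derive t 1 (fun t => x + d * cos t) (0 + d * - sin t).
    apply: is_deriveD; apply: is_deriveMl; exact: is_derive_cos.
  have h2 := @is_derive1_comp R (horner Q) (fun t => x + d * cos t) t _ _
    (is_derive_poly _ _) h1.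
  have h3 := is_deriveMl (- d^-1) h2.
  have := @is_deriveB _ _ _ _ _ t 1 _ _ h3 (dG t).
  move=> h; apply: is_derive_eq h _; rewrite Qq horner_exp /dPhi.
  by field; rewrite gt_eqF.
have [c + hc] := @MVT_segment R Phi dPhi 0 pi (pi_ge0 R) (fun t _ => dP t)
  (continuous_subspaceT (fun t => differentiable_continuous
    (proj1 (derivable1_diffP _ _) (@ex_derive _ _ _ _ _ _ _ (dP t))))).
rewrite in_itv/= => cpi.
have : 0 <= Phi pi - Phi 0.
  rewrite hc subr0 mulr_ge0 ?pi_ge0// /dPhi mulr_ge0 ?subr_ge0 ?sin_le1//.
  by rewrite mulr_ge0 ?sqr_ge0// sin_ge0_pi.
rewrite /Phi cospi cos0 mulr1 mulrN1 => hPhi.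
have : d * (G pi - G 0) <= Q.[x + d] - Q.[x - d].
  rewrite -(ler_pM2l (_ : 0 < d^-1)) ?invr_gt0// mulKf ?gt_eqF//; lra.
move=> /(ler_wpM2l (ler0n R N)); apply: le_trans.
by rewrite [leRHS]mulrCA [pi / 2 * d]mulrC -[leLHS]mulrA ler_pM2l.
Qed.

End SinePolynomials.

(** * Polynomial approximation of the inverse *)

Lemma size_geometric_poly (R : idomainType) (u : {poly R}) (K : nat) :
  (size u <= 3)%N -> (size ('X * \sum_(i < K) u ^+ i)%R <= K.*2)%N.
Proof.
case: K => [|K] su; first by rewrite big_ord0 mulr0 size_poly0.
apply: (leq_trans (size_polyMleq _ _)); rewrite size_polyX /= doubleS ltnS.
apply: (leq_trans (size_sum _ _ _)); apply/bigmax_leqP => i _.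
apply: (leq_trans (size_poly_exp_leq _ _)); rewrite ltnS -mul2n.
apply: (@leq_trans (2 * i)); last by rewrite leq_mul2l -ltnS ltn_ord.
by rewrite leq_mul2r; apply/orP; right; case: (size u) su.
Qed.

(** The approximant is (x / M^2) sum_(i < K) u^i with u = 1 - x^2 / M^2 and
    K = floor (N / 2); its error is exactly u^K / x, and 0 <= u <= 1 - d^2 / M^2
    on the set considered. *)
Lemma inv_poly_approx (R : realType) (d M : R) : 0 < d -> d < M ->
  exists c rho : R, [/\ 0 <= c, 0 < rho < 1 &
    forall N, exists2 q : {poly R}, (size q <= N)%N &
      forall x, d <= `|x| <= M -> `|x^-1 - q.[x]| <= c * rho ^+ N].
Proof.
move=> d0 dM; have M0 : 0 < M by exact: lt_trans dM.
pose r2 := 1 - (d / M) ^+ 2.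
have dM0 : 0 < d / M by rewrite divr_gt0.
have dM1 : d / M < 1 by rewrite ltr_pdivrMr// mul1r.
have r20 : 0 < r2 by rewrite /r2; nra.
have r21 : r2 < 1 by rewrite /r2; nra.
pose rho := Num.sqrt r2.
have rho0 : 0 < rho by rewrite sqrtr_gt0.
have rhoE : rho ^+ 2 = r2 by rewrite sqr_sqrtr// ltW.
have rho1 : rho < 1 by nra.
(* The factor rho^-1 makes up for the rounding of N / 2 when N is odd. *)
exists (d^-1 * rho^-1), rho; split.
- by rewrite mulr_ge0// invr_ge0 ltW.
- by rewrite rho0.
move=> N; pose u : {poly R} := 1 - (M ^- 2) *: 'X^2.
exists ((M ^- 2) *: ('X * \sum_(i < N./2) u ^+ i)).
  apply: (leq_trans (size_scale_leq _ _)).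
  apply: (@leq_trans (N./2).*2); last first.
    by rewrite -[leqRHS]odd_double_half leq_addl.
  apply: size_geometric_poly; rewrite /u.
  apply: (leq_trans (size_polyD _ _)); rewrite size_poly1 size_polyN geq_max//=.
  by apply: (leq_trans (size_scale_leq _ _)); rewrite size_polyXn.
move=> x /andP[dx xM].
have x0 : x != 0 by rewrite -normr_gt0; exact: lt_le_trans dx.
have uE : u.[x] = 1 - M ^- 2 * x ^+ 2 by rewrite /u !hornerE.
have -> : x^-1 - (M ^- 2 *: ('X * \sum_(i < N./2) u ^+ i)).[x]
    = x^-1 * u.[x] ^+ (N./2).
  have h := subrX1 u.[x] N./2.
  rewrite hornerZ hornerM hornerX horner_sum.
  under eq_bigr do rewrite horner_exp.
  set s := \sum_(i < _) _ in h *.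
  have -> : u.[x] ^+ (N./2) = 1 + (u.[x] - 1) * s by rewrite -h addrC subrK.
  by rewrite uE; field; rewrite x0 gt_eqF.
rewrite normrM normfV normrX.
have u0 : `|u.[x]| <= r2.
  have e : (x / M) ^+ 2 = `|x / M| ^+ 2 by rewrite real_normK// num_real.
  have n1 : d / M <= `|x / M|.
    by rewrite normrM normfV (gtr0_norm M0) ler_pM2r// invr_gt0.
  have n2 : `|x / M| <= 1.
    by rewrite normrM normfV (gtr0_norm M0) ler_pdivrMr// mul1r.
  rewrite uE (_ : M ^- 2 * x ^+ 2 = `|x / M| ^+ 2); last first.
    by rewrite -e exprMn exprVn mulrC.
  rewrite ger0_norm /r2; nra.
rewrite -mulrA ler_pM ?invr_ge0 ?exprn_ge0//.
  by rewrite lef_pV2// posrE ?normr_gt0.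
rewrite ler_pdivlMl//.
apply: (@le_trans _ _ (rho * r2 ^+ N./2)).
  by rewrite ler_pM2l// lerXn2r// nnegrE ltW.
rewrite -rhoE -exprM -exprS mul2n ler_wiXn2l ?ltW//.
by rewrite -[leqLHS]odd_double_half -add1n leq_add2r leq_b1.
Qed.

(** With s the fourth root of rho, N s^N is bounded by the geometric sum
    1 / (1 - s), and N^2 rho^N = (N s^N)^2 (s^2)^N. *)
Lemma cvg_sqr_geometric (R : realType) (rho : R) : 0 < rho < 1 ->
  (fun N : nat => N%:R ^+ 2 * rho ^+ N) @ \oo --> (0 : R).
Proof.
move=> /andP[r0 r1].
pose s := Num.sqrt (Num.sqrt rho).
have s0 : 0 < s by rewrite !sqrtr_gt0.
have s4 : s ^+ 4 = rho.
  by rewrite (exprM s 2 2) !sqr_sqrtr// ?sqrtr_ge0// ltW.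
have s1 : s < 1.
  rewrite ltNge; apply/negP => /(exprn_ege1 4); rewrite s4 => h.
  by move: (lt_le_trans r1 h); rewrite ltxx.
have B N : N%:R * s ^+ N * (1 - s) <= 1 - s ^+ N.
  elim: N => [|N IH]; first by rewrite !mul0r expr0 subrr.
  have sN : 0 <= s ^+ N by rewrite exprn_ge0// ltW.
  have sN1 : s ^+ N <= 1 by rewrite exprn_ile1// ltW.
  have h1 : 0 <= (1 - s) * (1 - s * s ^+ N) by rewrite mulr_ge0 ?subr_ge0; nra.
  have := ler_wpM2l (ltW s0) IH.
  by rewrite -natr1 exprS; nra.
have C N : N%:R ^+ 2 * rho ^+ N <= (1 - s) ^- 2 * (s ^+ 2) ^+ N.
  have -> : rho ^+ N = (s ^+ N) ^+ 2 * (s ^+ 2) ^+ N.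
    by rewrite -s4 -!exprM -exprD; congr (_ ^+ _); rewrite (mulnC N) -mulnDl.
  rewrite mulrA ler_pM2r ?exprn_gt0// -exprMn -exprVn lerXn2r ?nnegrE//.
  - by rewrite mulr_ge0// exprn_ge0// ltW.
  - by rewrite invr_ge0 subr_ge0 ltW.
  rewrite -[leRHS]mul1r ler_pdivlMr ?subr_gt0//.
  by apply: (le_trans (B N)); rewrite gerBl exprn_ge0// ltW.
apply: (@squeeze_cvgr _ _ _ _ (fun=> 0) (fun N => (1 - s) ^- 2 * (s ^+ 2) ^+ N)).
- by near=> N; rewrite C andbT mulr_ge0 ?exprn_ge0// ltW.
- exact: cvg_cst.
rewrite -(mulr0 ((1 - s) ^- 2)); apply: cvgMr.
apply: cvg_expr; rewrite ger0_norm ?sqr_ge0//.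
by rewrite expr_lt1// ltW.
Unshelve. all: by end_near.
Qed.

(** * Expansion in orthonormal polynomials *)

Lemma poly_primitive (R : numFieldType) (p : {poly R}) :
  exists P : {poly R}, P^`() = p.
Proof.
exists (\sum_(i < size p) (p`_i / i.+1%:R) *: 'X^(i.+1)).
rewrite raddf_sum -[RHS]coefK poly_def; apply: eq_bigr => i _.
rewrite /= derivZ derivXn -(scaler_nat i.+1 ('X^i : {poly R})) scalerA.
by rewrite divfK ?pnatr_eq0.
Qed.

Section WeightedIntegral.
Variables (R : realType) (K : set R) (w : R -> R).
Hypothesis mK : measurable K.
Hypothesis w0 : forall x, K x -> 0 <= w x.
Hypothesis iw : lebesgue_measure.-integrable K (EFin \o w).
Implicit Types (f h : R -> R) (q : {poly R}).

Notation mu := (@lebesgue_measure R).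

(** The class of integrands used below: it is stable under products, contains
    the polynomials and 1/x, and is integrable against w. *)
Definition bounded_measurable f : Prop :=
  measurable_fun K f /\ exists B, forall x, K x -> `|f x| <= B.

Definition weighted_int f : R := \int[mu]_(x in K) (f x * w x).

Lemma bounded_measurable_integrable f :
  bounded_measurable f -> mu.-integrable K (EFin \o (fun x => f x * w x)).
Proof.
move=> [mf [B hB]].
have h : [bounded f x | x in K].
  exists B; split; first exact: num_real.
  by move=> M BM x Kx; apply: le_trans (hB x Kx) _; exact: ltW.
have := @integrableMr _ _ _ mu K mK f (EFin \o w) mf h iw.
by apply: eq_integrable => // x _.
Qed.

Lemma bounded_measurableD f h : bounded_measurable f -> bounded_measurable h ->
  bounded_measurable (fun x => f x + h x).
Proof.
move=> [mf [B hB]] [mh [B' hB']]; split; first exact: measurable_funD.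
exists (B + B') => x Kx; apply: le_trans (ler_normD _ _) _.
by rewrite lerD ?hB ?hB'.
Qed.

Lemma bounded_measurableM f h : bounded_measurable f -> bounded_measurable h ->
  bounded_measurable (fun x => f x * h x).
Proof.
move=> [mf [B hB]] [mh [B' hB']]; split; first exact: measurable_funM.
exists (B * B') => x Kx; rewrite normrM.
by rewrite ler_pM ?hB ?hB'.
Qed.

Lemma bounded_measurable_cst c : bounded_measurable (fun=> c).
Proof. by split; [exact: measurable_cst|exists `|c|]. Qed.

Lemma bounded_measurable_norm f : bounded_measurable f ->
  bounded_measurable (fun x => `|f x|).
Proof.
move=> [mf [B hB]]; split; first exact: measurableT_comp.
by exists B => x Kx; rewrite normr_id hB.
Qed.

Lemma weighted_intD f h : bounded_measurable f -> bounded_measurable h ->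
  weighted_int (fun x => f x + h x) = weighted_int f + weighted_int h.
Proof.
move=> bf bh; rewrite /weighted_int -RintegralD//;
  try exact: bounded_measurable_integrable.
by apply: eq_Rintegral => x _; rewrite mulrDl.
Qed.

Lemma weighted_intZ c f : bounded_measurable f ->
  weighted_int (fun x => c * f x) = c * weighted_int f.
Proof.
move=> bf; rewrite /weighted_int -RintegralZl//;
  try exact: bounded_measurable_integrable.
by apply: eq_Rintegral => x _; rewrite mulrA.
Qed.

Lemma weighted_int_le f h : bounded_measurable f -> bounded_measurable h ->
  (forall x, K x -> f x <= h x) -> weighted_int f <= weighted_int h.
Proof.
move=> bf bh fh; apply: le_Rintegral => //; try exact: bounded_measurable_integrable.
by move=> x Kx; rewrite ler_wpM2r ?w0 ?fh.
Qed.

Lemma weighted_int_norm f : bounded_measurable f ->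
  `|weighted_int f| <= weighted_int (fun x => `|f x|).
Proof.
move=> bf; apply: (le_trans (le_normr_Rintegral _ _)) => //.
  exact: bounded_measurable_integrable.
rewrite le_eqVlt; apply/orP; left; apply/eqP; apply: eq_Rintegral => x.
by rewrite inE => Kx; rewrite normrM (ger0_norm (w0 Kx)).
Qed.

Section Polynomials.
Variable M : R.
Hypothesis KM : forall x, K x -> `|x| <= M.

Lemma bounded_measurable_horner q : bounded_measurable (horner q).
Proof.
split; first exact: measurable_poly.
elim/poly_ind: q => [|q c [B hB]].
  by exists 0 => x _; rewrite horner0 normr0.
exists (B * M + `|c|) => x Kx; rewrite hornerD hornerMX hornerC.
by rewrite (le_trans (ler_normD _ _))// lerD2r normrM ler_pM ?hB ?KM.
Qed.

Lemma weighted_int_horner_sum N (c : nat -> R) (p : nat -> {poly R}) :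
  weighted_int (horner (\sum_(j < N) c j *: p j)) =
  \sum_(j < N) c j * weighted_int (horner (p j)).
Proof.
elim: N => [|N IH].
  rewrite !big_ord0 /weighted_int -(mul0r (weighted_int (fun=> 0))) -weighted_intZ.
    by apply: eq_Rintegral => x _; rewrite horner0 mul0r.
  exact: bounded_measurable_cst.
rewrite !big_ord_recr /= -IH -weighted_intZ; last exact: bounded_measurable_horner.
rewrite -weighted_intD; last 2 first.
- exact: bounded_measurable_horner.
- apply: bounded_measurableM; first exact: bounded_measurable_cst.
  exact: bounded_measurable_horner.
by apply: eq_Rintegral => x _; rewrite hornerD hornerZ.
Qed.

Section Orthonormal.
Variable p : nat -> {poly R}.
Hypothesis wp : orthonormal_polys K w p.
Hypothesis w1 : weighted_int (fun=> 1) = 1.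

Lemma orthonormal_polys_span N q : (size q <= N)%N ->
  exists c : nat -> R, q = \sum_(j < N) c j *: p j.
Proof.
have [hp _] := wp.
elim: N q => [|N IH] q sq.
  exists (fun=> 0); rewrite big_ord0; apply/eqP.
  by rewrite -size_poly_eq0 -leqn0.
have [sp lp] := hp N.
have pN0 : (p N)`_N != 0 by move: lp; rewrite lead_coefE sp => /gt_eqF ->.
pose a := q`_N / (p N)`_N.
have /IH[c hc] : (size (q - a *: p N)%R <= N)%N.
  apply/leq_sizeP => j; rewrite leq_eqVlt => /predU1P[<-|Nj].
    by rewrite coefB coefZ /a divfK// subrr.
  rewrite coefB coefZ !nth_default ?mulr0 ?subrr// ?sp//.
  exact: leq_trans sq _.
exists (fun j => if (j == N)%N then a else c j).
rewrite big_ord_recr /= eqxx -[LHS](subrK (a *: p N)) hc; congr (_ + _).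
by apply: eq_bigr => j _; rewrite ltn_eqF.
Qed.

Lemma orthonormal_polys_expand N q x : (size q <= N)%N ->
  q.[x] = \sum_(j < N) weighted_int (fun y => q.[y] * (p j).[y]) * (p j).[x].
Proof.
move=> /orthonormal_polys_span[c ->]; rewrite horner_sum; apply: eq_bigr => k _.
rewrite hornerZ; congr (_ * _).
transitivity (weighted_int (horner (\sum_(j < N) c j *: (p j * p k)))).
  rewrite (weighted_int_horner_sum _ _ (fun j => p j * p k)) (bigD1 k) //=.
  rewrite big1 => [|j jk].
    have := proj2 wp k k; rewrite eqxx => h.
    rewrite addr0 -[LHS]mulr1; congr (_ * _); rewrite -[LHS]h.
    by apply: eq_Rintegral => y _; rewrite hornerM.
  have := proj2 wp j k; rewrite val_eqE (negbTE jk) => h.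
  rewrite [X in _ * X](_ : _ = 0) ?mulr0// -[RHS]h.
  by apply: eq_Rintegral => y _; rewrite hornerM.
apply: eq_Rintegral => y _; rewrite -hornerM mulr_suml; congr (_.[_] * _).
by apply: eq_bigr => j _; rewrite scalerAl.
Qed.

(** The inequality |p_j| <= (1 + p_j^2) / 2 takes the place of Cauchy-Schwarz:
    w and p_j^2 w both have integral 1. *)
Lemma fourier_coef_norm_le f j E : bounded_measurable f ->
  (forall x, K x -> `|f x| <= E) -> `|weighted_int (fun x => f x * (p j).[x])| <= E.
Proof.
move=> bf fE.
have bp := bounded_measurable_horner (p j).
have bfp := bounded_measurableM bf bp.
have b1 := bounded_measurable_cst 1.
have bpp := bounded_measurableM bp bp.
have bs := bounded_measurableD b1 bpp.
apply: (le_trans (weighted_int_norm bfp)).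
have -> : E = weighted_int (fun x => E / 2 * (1 + (p j).[x] * (p j).[x])).
  rewrite weighted_intZ// weighted_intD// w1.
  have := proj2 wp j j; rewrite eqxx => h.
  by rewrite [X in 1 + X]h /=; field.
apply: weighted_int_le => [||x Kx]; first exact: bounded_measurable_norm.
  by apply: bounded_measurableM => //; exact: bounded_measurable_cst.
have := fE x Kx; rewrite normrM => h.
have : `|(p j).[x]| <= (1 + (p j).[x] * (p j).[x]) / 2.
  have e : `|(p j).[x]| ^+ 2 = (p j).[x] ^+ 2 by rewrite real_normK// num_real.
  by have := sqr_ge0 (`|(p j).[x]| - 1); rewrite expr2 in e; nra.
by move=> h2; rewrite mulrAC -mulrA ler_pM.
Qed.

(** The integral of p_j^2 w being 1, that of p_j^2 over [x - d, x + d] is at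
    most 1 / c, and [sqr_horner_center_le] applies with N = j + 1. *)
Lemma orthonormal_poly_value_le (x c d : R) : 0 < c -> 0 < d ->
  `[x - d, x + d] `<=` K ->
  (forall y : R, `[x - d, x + d]%classic y -> c <= w y) ->
  exists D : R, forall j, (p j).[x] ^+ 2 <= D * j.+1%:R.
Proof.
move=> c0 d0 IK wc.
exists ((c * (pi / 2) * d)^-1) => j.
have [Q hQ] := poly_primitive (p j ^+ 2).
have cd0 : 0 < c * (pi / 2) * d by rewrite !mulr_gt0 ?invr_gt0 ?pi_gt0.
have bp := bounded_measurable_horner (p j).
have := @sqr_horner_center_le R j.+1 (p j) Q x d d0.
rewrite (proj1 (proj1 wp j)) => /(_ (leqnn _) hQ) hv.
have xd : x - d < x + d by lra.
have ftc : (\int[mu]_(y in `[(x - d)%R, (x + d)%R]) ((p j).[y] ^+ 2)%:E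
    = (Q.[x + d])%:E - (Q.[x - d])%:E)%E.
  apply: (continuous_FTC2 xd).
  - apply: continuous_subspaceT => y.
    under eq_fun do rewrite -horner_exp; exact: continuous_horner.
  - split; first by move=> y _; exact: derivable_horner.
      by apply: cvg_at_right_filter; exact: continuous_horner.
    by apply: cvg_at_left_filter; exact: continuous_horner.
  - by move=> y _; rewrite -derivE hQ horner_exp.
have bpp := bounded_measurableM bp bp.
have ipp := bounded_measurable_integrable bpp.
have mI : measurable `[x - d, x + d]%classic by exact: measurable_itv.
have wJ : (\int[mu]_(y in K) ((p j).[y] * (p j).[y] * w y)%:E = 1)%E.
  have := proj2 wp j j; rewrite eqxx /Rintegral => h.
  by rewrite -[LHS]fineK ?h//; exact: integrable_fin_num.
have le1 : c * (Q.[x + d] - Q.[x - d]) <= 1.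
  rewrite -lee_fin -wJ EFinM EFinB -ftc.
  rewrite -ge0_integralZl_EFin ?(ltW c0)//; last 2 first.
  - by move=> y _; rewrite lee_fin sqr_ge0.
  - apply/measurable_EFinP; apply: measurable_funX; exact: measurable_poly.
  apply: (@le_trans _ _ (\int[mu]_(y in `[(x - d)%R, (x + d)%R])
      ((p j).[y] * (p j).[y] * w y)%:E)%E).
    apply: ge0_le_integral => //.
    - by move=> y _; rewrite lee_fin mulr_ge0 ?sqr_ge0// ltW.
    - apply/measurable_EFinP; apply: measurable_funM => //.
      apply: measurable_funX; exact: measurable_poly.
    - apply: (measurable_funS mK IK); exact: measurable_int ipp.
    - move=> y yI; rewrite lee_fin -expr2 mulrC ler_wpM2l ?sqr_ge0//.
      exact: wc.
  apply: ge0_subset_integral => //.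
  - exact: measurable_int ipp.
  - by move=> y Ky; rewrite lee_fin -expr2 mulr_ge0 ?sqr_ge0 ?w0.
rewrite ler_pdivlMl//.
apply: (@le_trans _ _ (c * (j.+1%:R * (Q.[x + d] - Q.[x - d])))).
  by rewrite -(mulrA c (pi / 2)) -(mulrA c (pi / 2 * d)) ler_pM2l.
by rewrite mulrCA -[leRHS]mulr1 ler_pM2l// ltr0n.
Qed.

Hypothesis K0 : exists2 d : R, 0 < d & forall x, K x -> d <= `|x|.

Lemma bounded_measurable_inv : bounded_measurable (fun x => x^-1).
Proof.
have [d d0 Kd] := K0; split.
  apply: subspace_continuous_measurable_fun => //.
  apply: continuous_in_subspaceT => x; rewrite inE => /Kd dx.
  by apply: inv_continuous; rewrite -normr_gt0; exact: lt_le_trans dx.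
exists d^-1 => x /Kd dx.
by rewrite normfV lef_pV2// posrE//; exact: lt_le_trans dx.
Qed.

(** If q approximates 1/x and has degree below N, then replacing 1/x by 1/x - q
    does not change the error of the partial sum of order N, since q is
    reproduced; both terms of the new error are small. *)
Lemma fourier_inv_cvg (x c d : R) : 0 < c -> 0 < d ->
  `[x - d, x + d] `<=` K ->
  (forall y : R, `[x - d, x + d]%classic y -> c <= w y) ->
  (fun N : nat =>
     \sum_(j < N) weighted_int (fun y => y^-1 * (p j).[y]) * (p j).[x]) @ \oo
     --> x^-1.
Proof.
move=> c0 d0 IK wc.
have [D hD] := orthonormal_poly_value_le c0 d0 IK wc.
have Kx : K x by apply: IK; rewrite /= in_itv/=; lra.
have D0 : 0 <= D by have := hD 0; rewrite mulr1; apply: le_trans; rewrite sqr_ge0.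
have [dl dl0 Kdl] := K0.
have dM : dl < M + dl + 1 by have := KM Kx; have := normr_ge0 x; lra.
have [C [rho [C0 rho01 happ]]] := inv_poly_approx dl0 dM.
have [rho0 rho1] := andP rho01.
(* |p_j(x)| <= 1 + p_j(x)^2 <= 1 + D N for j < N; summing over j gives at most
   N + D N^2 <= (2 + D) N^2, and the last term bounds |1/x - q(x)|. *)
pose e N := C * (2 + D) * (N%:R ^+ 2 * rho ^+ N) + C * rho ^+ N.
have ecvg : e @ \oo --> (0 : R).
  rewrite -(addr0 0) -[X in X + _](mulr0 (C * (2 + D))) -[X in _ + X](mulr0 C).
  apply: cvgD; apply: cvgMr; first exact: cvg_sqr_geometric.
  by apply: cvg_expr; rewrite ger0_norm ?ltW.
have Se N : `|\sum_(j < N) weighted_int (fun y => y^-1 * (p j).[y]) * (p j).[x]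
    - x^-1| <= e N.
  have [q sq hq] := happ N; set E := C * rho ^+ N in hq *.
  have E0 : 0 <= E by rewrite mulr_ge0// exprn_ge0// ltW.
  have qE y : K y -> `|y^-1 - q.[y]| <= E.
    by move=> Ky; apply: hq; rewrite Kdl//=; have := KM Ky; lra.
  have binv := bounded_measurable_inv.
  have bq := bounded_measurable_horner q.
  have bdiff : bounded_measurable (fun y => y^-1 - q.[y]).
    have bNq := bounded_measurable_horner (- q).
    have := bounded_measurableD binv bNq.
    by congr bounded_measurable; apply/funext => y; rewrite hornerN.
  have -> : \sum_(j < N) weighted_int (fun y => y^-1 * (p j).[y]) * (p j).[x]
      - x^-1 =
      \sum_(j < N) weighted_int (fun y => (y^-1 - q.[y]) * (p j).[y]) * (p j).[x]
      - (x^-1 - q.[x]).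
    rewrite opprB addrA; congr (_ - _).
    rewrite [in X in _ + X](orthonormal_polys_expand x sq) -big_split /=.
    apply: eq_bigr => j _; rewrite -mulrDl; congr (_ * _).
    have bp := bounded_measurable_horner (p j).
    rewrite -weighted_intD; try exact: bounded_measurableM.
    by congr weighted_int; apply/funext => y; rewrite -mulrDl subrK.
  apply: (le_trans (ler_normB _ _)); apply: lerD (qE x Kx).
  apply: (le_trans (ler_norm_sum _ _ _)).
  apply: (@le_trans _ _ (\sum_(j < N) E * (1 + D * N%:R))).
    apply: ler_sum => j _; rewrite normrM ler_pM//.
      exact: fourier_coef_norm_le.
    have h1 : `|(p j).[x]| ^+ 2 <= D * j.+1%:R.
      by rewrite real_normK ?num_real.
    have h2 : D * j.+1%:R <= D * N%:R by rewrite ler_wpM2l// ler_nat.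
    by have := sqr_ge0 (`|(p j).[x]| - 1); nra.
  rewrite sumr_const card_ord -[leLHS]mulr_natl.
  have NN : N%:R <= N%:R ^+ 2 :> R.
    by rewrite -natrX ler_nat -mulnn; case: (N) => // k; exact: leq_pmulr.
  rewrite (_ : C * _ * _ = E * ((2 + D) * N%:R ^+ 2)); last by rewrite /E; ring.
  rewrite mulrCA ler_wpM2l//; nra.
apply: (@squeeze_cvgr _ _ _ _ (fun N => x^-1 - e N) (fun N => x^-1 + e N)).
- near=> N; have := Se N; rewrite ler_norml => /andP[]; lra.
- rewrite -[X in _ --> X]subr0; apply: cvgB ecvg; exact: cvg_cst.
- rewrite -[X in _ --> X]addr0; apply: cvgD ecvg; exact: cvg_cst.
Unshelve. all: by end_near.
Qed.

End Orthonormal.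
End Polynomials.
End WeightedIntegral.

(** * Convergence of complex matrices *)

Lemma cvg_mx_entries (T : topologicalType) (m n : nat) (I : Type)
    (F : set_system I) (u : I -> 'M[T]_(m, n)) (X : 'M[T]_(m, n)) :
  Filter F -> (forall i j, (fun k => u k i j) @ F --> X i j) -> u @ F --> X.
Proof.
move=> FF h A [P hP PA].
have : \forall k \near F, forall i j, P i j (u k i j).
  by do 2 apply: filter_forall => ?; apply: h; exact: hP.
by apply: filterS => k hk; apply: PA.
Qed.

Lemma cvg_real_complex (R : realType) (u : nat -> R) (x : R) :
  u @ \oo --> x -> (fun N => (u N)%:C : R[i]^o) @ \oo --> (x%:C : R[i]^o).
Proof.
move=> /cvgrPdist_lt h; apply/cvgrPdist_lt => e e0.
have er : e = (complex.Re e)%:C by rewrite RRe_real// gtr0_real.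
have er0 : 0 < complex.Re e by rewrite -ltcR -er.
have := h _ er0; apply: filterS => N hN.
have -> : x%:C - (u N)%:C = (x - u N)%:C :> R[i]^o by rewrite rmorphB.
rewrite er -[`|_|]/(`|(x - u N)%:C : R[i]|).
by rewrite normc_def/= expr0n/= addr0 sqrtr_sqr ltcR.
Qed.

Lemma cvg_mulmx_real (R : realType) (k l m n : nat) (U : 'M[R[i]]_(k, m))
    (V : 'M[R[i]]_(n, l)) (C : 'M[R[i]]_(m, n))
    (s : nat -> 'I_m -> 'I_n -> R) (t : 'I_m -> 'I_n -> R) :
  (forall i j, (fun N => s N i j) @ \oo --> t i j) ->
  (fun N : nat => (U *m (\matrix_(i, j) ((s N i j)%:C * C i j)) *m V
      : 'M[R[i]^o]_(k, l))) @ \oo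
    --> (U *m (\matrix_(i, j) ((t i j)%:C * C i j)) *m V : 'M[R[i]^o]_(k, l)).
Proof.
move=> h; apply: cvg_mx_entries => a b.
pose F (r : 'I_m -> 'I_n -> R) : R[i]^o :=
  \sum_j \sum_i (V j b * (U a i * C i j)) * (r i j)%:C.
have FE r : (U *m (\matrix_(i, j) ((r i j)%:C * C i j)) *m V) a b = F r.
  rewrite mxE; apply: eq_bigr => j _; rewrite mxE mulr_suml.
  by apply: eq_bigr => i _; rewrite mxE; ring.
rewrite FE; under eq_fun do rewrite FE.
apply: cvg_big => [|j _]; first exact: add_continuous.
apply: cvg_big => [|i _]; first exact: add_continuous.
apply: (@cvgMl_tmp R[i]); exact: cvg_real_complex.
Qed.

(** * The Sylvester operator in eigenvector coordinates *)

Section Sylvester.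
Variables (F : fieldType) (m n : nat).

Lemma sylvester_spectrumP (A : 'M[F]_n) (B : 'M[F]_m) (l : F)
    (Y : 'M[F]_(m, n)) :
  Y != 0 -> sylvester A B Y = l *: Y -> sylvester_spectrum A B l.
Proof.
move=> Y0 SY; rewrite /sylvester_spectrum /= /passmx.leigenvalue.
apply: contraNneq Y0 => h.
have : Y \in passmx.leigenspace (linfun (sylvester A B)) l.
  by rewrite memv_ker !lfun_simp /= SY subrr.
by rewrite h memv0.
Qed.

Lemma sylvester_conj (A : 'M[F]_n) (B : 'M[F]_m) (V : 'M[F]_n) (W : 'M[F]_m)
    (da : 'rV[F]_n) (db : 'rV[F]_m) (Z : 'M[F]_(m, n)) :
  W \in unitmx -> V *m A = diag_mx da *m V -> W *m B = diag_mx db *m W ->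
  sylvester A B (invmx W *m Z *m V) =
  invmx W *m (\matrix_(i, j) ((da 0 j - db 0 i) * Z i j)) *m V.
Proof.
move=> Wu VA WB; rewrite /sylvester.
have BW : B *m invmx W = invmx W *m diag_mx db.
  by rewrite -[LHS](mulKmx Wu) (mulmxA W) WB -!mulmxA mulmxV// mulmx1.
rewrite -!mulmxA VA !mulmxA BW -!mulmxA -mulmxBr !mulmxA -mulmxBl -mulmxA.
congr (_ *m (_ *m _)); rewrite mul_mx_diag mul_diag_mx.
by apply/matrixP => i j; rewrite !mxE; ring.
Qed.

End Sylvester.

(** * Unions of intervals and admissible weights *)

Section IntervalUnion.
Variables (R : realType) (g : nat) (beta gamma : 'I_g.+1 -> R).
Notation Sigma := (interval_union beta gamma).
Notation mu := (@lebesgue_measure R).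

Lemma closed_interval_union : closed Sigma.
Proof.
by apply: closed_bigcup => [|i _]; [exact: finite_finset|exact: itv_closed].
Qed.

Lemma measurable_interval_union : measurable Sigma.
Proof. exact: closed_measurable closed_interval_union. Qed.

Lemma interval_union_bounded : exists M, forall x, Sigma x -> `|x| <= M.
Proof.
exists (\sum_j (`|beta j| + `|gamma j|)) => x [j _ /=]; rewrite in_itv/= => bx.
rewrite (bigD1 j)//= -[leLHS]addr0; apply: lerD; last first.
  by apply: sumr_ge0 => i _; rewrite addr_ge0.
rewrite ler_norml; have := ler_norm (gamma j); have := ler_norm (- beta j).
by rewrite normrN; have := normr_ge0 (gamma j); have := normr_ge0 (beta j); lra.
Qed.

Lemma interval_union_away0 : ~ Sigma 0 ->
  exists2 d : R, 0 < d & forall x, Sigma x -> d <= `|x|.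
Proof.
move=> n0; have /open_nbhs_nbhs : open_nbhs (0 : R) (~` Sigma).
  by split=> //; exact: closed_openC closed_interval_union.
move=> /nbhs_ballP[d /= d0 hd]; exists d => // x Sx.
rewrite leNgt; apply/negP => xd; apply: (hd x) => //.
by rewrite /ball /= sub0r normrN.
Qed.

(** The open intervals lie in the interior of Sigma, and adding their end points
    preserves measurability. *)
Lemma measurable_interior_continuous (w : R -> R) :
  (forall x, interior Sigma x -> {for x, continuous w}) ->
  measurable_fun Sigma w.
Proof.
move=> cw.
(* Seen as a sequence of sets, the union repeats an interval beyond index g,
   where [inord] takes its default value. *)
have -> : Sigma = \bigcup_k `[beta (inord k), gamma (inord k)]%classic.
  apply/seteqP; split=> x [j _ hj]; first by exists j => //; rewrite inord_val.
  by exists (inord j).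
apply/measurable_fun_bigcup => [k|k]; first exact: measurable_itv.
apply: (@measurable_fun_itv_cc _ _ _ false true).
apply: subspace_continuous_measurable_fun => //.
apply: continuous_in_subspaceT => x; rewrite inE => xk; apply: cw.
have oo : open `]beta (inord k), gamma (inord k)[%classic by exact: itv_open.
suff : `]beta (inord k), gamma (inord k)[ `<=` Sigma.
  by rewrite open_subsetE//; apply.
move=> y /= /[!in_itv]/= /andP[y1 y2]; exists (inord k) => //=.
by rewrite in_itv/= !ltW.
Qed.

(** The normalization makes the integral finite: a real integral equal to 1
    cannot come from an infinite extended integral, whose real value is 0. *)
Lemma admissible_weight_integrable w : admissible_weight beta gamma w ->
  mu.-integrable Sigma (EFin \o w).
Proof.
move=> hw; apply/integrableP; split.
  apply/measurable_EFinP; apply: measurable_interior_continuous.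
  exact: (weight_cont hw).
have e : (\int[mu]_(x in Sigma) `|(EFin \o w) x| =
    \int[mu]_(x in Sigma) (w x)%:E)%E.
  by apply: eq_integral => x _; rewrite /= ger0_norm// (weight_ge0 hw).
rewrite e; have := weight_int hw; rewrite /Rintegral.
have : (0 <= \int[mu]_(x in Sigma) (w x)%:E)%E.
  by apply: integral_ge0 => x _; rewrite lee_fin (weight_ge0 hw).
case: (\int[mu]_(x in Sigma) (w x)%:E)%E => [r|//|//] _ /=; first by rewrite ltry.
by move=> /eqP; rewrite eq_sym oner_eq0.
Qed.

Lemma admissible_weight_local w x : admissible_weight beta gamma w ->
  interior Sigma x -> exists c d, [/\ 0 < c, 0 < d,
    `[x - d, x + d] `<=` Sigma &
    forall y, `[x - d, x + d]%classic y -> c <= w y].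
Proof.
move=> hw ix; have wx := weight_gt0 hw ix.
have : \forall y \near x, Sigma y /\ w x / 2 < w y.
  near=> y; split; first by near: y; exact: ix.
  near: y; apply: (cvgr_gt (w x)); first exact: (weight_cont hw).
  by rewrite ltr_pdivrMr// mulr_natr mulr2n ltrDl.
move=> /nbhs_ballP[d /= d0 hd]; exists (w x / 2), (d / 2).
have B y : `[x - d / 2, x + d / 2]%classic y -> ball x d y.
  by rewrite /= in_itv/= /ball/= => h; rewrite ltr_norml; lra.
split; rewrite ?divr_gt0// => y /B /hd[]// _ /ltW; exact.
Unshelve. all: by end_near.
Qed.

End IntervalUnion.

(** * Solution of the Sylvester equation *)

(** The factors 2 pi i cancel and the integrand at z = 0 is real, so alpha_j is
    the coefficient of 1/x on p_j. *)
Lemma series_coefE (R : realType) (S : set R) (w : R -> R)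
    (p : nat -> {poly R}) j :
  series_coef S w p j = (weighted_int S w (fun x => x^-1 * (p j).[x]))%:C.
Proof.
rewrite /series_coef /cauchy_transform mulrA divff ?mul1r; last first.
  rewrite /two_pi_i !mulf_neq0 ?pnatr_eq0//.
  - by rewrite fmorph_eq0 gt_eqF ?pi_gt0.
  - by apply/eqP => -[] /eqP; rewrite oner_eq0.
rewrite /Cintegral.
have e x : ((p j).[x] * w x)%:C / (x%:C - 0) =
    (x^-1 * (p j).[x] * w x)%:C :> R[i].
  by rewrite subr0 -fmorphV -rmorphM /= mulrC mulrA.
have -> : \int[lebesgue_measure]_(x in S)
    complex.Im (((p j).[x] * w x)%:C / (x%:C - 0)) = 0.
  rewrite /Rintegral; under eq_integral do rewrite e /=.
  by rewrite integral0.
congr (_ +i* _); by apply: eq_Rintegral => x _; rewrite e.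
Qed.

(** p_0 is a positive constant with p_0^2 int w = 1. The value 1 lets the matrix
    recurrence, which starts from C itself, match the scalar one. *)
Lemma orthonormal_polys_0 (R : realType) (K : set R) w (p : nat -> {poly R}) :
  measurable K -> (@lebesgue_measure R).-integrable K (EFin \o w) ->
  weighted_int K w (fun=> 1) = 1 -> orthonormal_polys K w p -> p 0%N = 1.
Proof.
move=> mK iw w1 [hp op]; have [/eqP s0 l0] := hp 0%N.
have /size_poly1P[c c0 pc] := s0.
move: l0; rewrite pc lead_coefC => cp.
have := op 0%N 0%N; rewrite eqxx.
have -> : \int[lebesgue_measure]_(x in K) ((p 0%N).[x] * (p 0%N).[x] * w x) =
   c * c.
  rewrite -[RHS]mulr1 -w1 -weighted_intZ//; last exact: bounded_measurable_cst.
  by apply: eq_Rintegral => x _; rewrite pc hornerC mulr1.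
move=> cc; have -> // : c = 1; rewrite /= in cc; nra.
Qed.

(** In eigenvector coordinates the operator multiplies the entry (i, j) by
    x i j, exactly as multiplication by 'X acts on the values p_k(x i j). *)
Lemma sylvester_recurrence_horner (R : realType) (m n : nat) (A : 'M[R[i]]_n)
    (B : 'M[R[i]]_m) (C' : 'M[R[i]]_(m, n)) (V : 'M[R[i]]_n) (W : 'M[R[i]]_m)
    (da : 'rV[R[i]]_n) (db : 'rV[R[i]]_m) (x : 'I_m -> 'I_n -> R)
    (p : nat -> {poly R}) (a b : nat -> R) (P : nat -> 'M[R[i]]_(m, n)) :
  W \in unitmx -> V *m A = diag_mx da *m V -> W *m B = diag_mx db *m W ->
  (forall i j, da 0 j - db 0 i = (x i j)%:C) -> p 0%N = 1 ->
  recurrence_coefs p a b ->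
  sylvester_recurrence A B (invmx W *m C' *m V) a b P ->
  forall k, P k =
    invmx W *m (\matrix_(i, j) ((p k).[x i j]%:C * C' i j)) *m V.
Proof.
move=> Wu VA WB hx p0 [b0 h1 hS] [P0 P1 PS].
pose L Z := invmx W *m Z *m V.
have LD Y Z : L (Y + Z) = L Y + L Z by rewrite /L mulmxDr mulmxDl.
have LZ c Z : L (c *: Z) = c *: L Z by rewrite /L -scalemxAr -scalemxAl.
have SL Z : L Z *m A - B *m L Z = L (\matrix_(i, j) ((x i j)%:C * Z i j)).
  rewrite -/(sylvester A B _) (sylvester_conj _ Wu VA WB).
  by under eq_mx do rewrite hx.
pose M k : 'M[R[i]]_(m, n) := \matrix_(i, j) ((p k).[x i j]%:C * C' i j).
have XM0 : \matrix_(i, j) ((x i j)%:C * M 0%N i j) =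
    (a 0%N)%:C *: M 0%N + (b 0%N)%:C *: M 1%N.
  apply/matrixP => i j; rewrite !mxE.
  have /(congr1 (fun q => (q.[x i j])%:C : R[i])) := h1.
  rewrite hornerM hornerX hornerD !hornerZ !(rmorphM, rmorphD) /= => h.
  by rewrite mulrA h; ring.
have XM k : \matrix_(i, j) ((x i j)%:C * M k.+1 i j) =
    (b k)%:C *: M k + (a k.+1)%:C *: M k.+1 + (b k.+1)%:C *: M k.+2.
  apply/matrixP => i j; rewrite !mxE.
  have /(congr1 (fun q => (q.[x i j])%:C : R[i])) := hS k.
  rewrite hornerM hornerX !hornerD !hornerZ !(rmorphM, rmorphD) /= => h.
  by rewrite mulrA h; ring.
have E0 : P 0%N = L (M 0%N).
  rewrite P0 -/(L C'); congr L; apply/matrixP => i j.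
  by rewrite mxE p0 hornerC mul1r.
have bC k : (b k)%:C != 0 :> R[i] by rewrite fmorph_eq0 gt_eqF.
change (forall k, P k = L (M k)).
(* From here on L and M matter through the relations above only. *)
clearbody L M.
suff H k : P k = L (M k) /\ P k.+1 = L (M k.+1) by move=> k; exact: (proj1 (H k)).
elim: k => [|k [IH1 IH2]].
  split; first exact: E0.
  by rewrite P1 E0 SL XM0 LD !LZ [X in X - _]addrC addrK scalerK.
split; first exact: IH2.
rewrite PS IH1 IH2 SL XM !LD !LZ -addrA -opprD [X in - X]addrC addrC addKr.
by rewrite scalerK.
Qed.

Theorem theorem4p1 (R : realType) (m n g : nat)
    (A : 'M[R[i]]_n) (B : 'M[R[i]]_m) (C : 'M[R[i]]_(m, n))
    (beta gamma : 'I_g.+1 -> R) (w : R -> R)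
    (p : nat -> {poly R}) (a b : nat -> R) (P : nat -> 'M[R[i]]_(m, n)) :
  diagonalizable A ->
  diagonalizable B ->
  (forall j, beta j < gamma j) ->
  trivIset [set: 'I_g.+1] (fun j => `[beta j, gamma j]%classic) ->
  ~ interval_union beta gamma 0 ->
  sylvester_spectrum A B `<=`
    [set x%:C | x in interior (interval_union beta gamma)] ->
  admissible_weight beta gamma w ->
  orthonormal_polys (interval_union beta gamma) w p ->
  recurrence_coefs p a b ->
  sylvester_recurrence A B C a b P ->
  exists X : 'M[R[i]]_(m, n),
    [/\ sylvester A B X = C,
        (forall Y : 'M[R[i]]_(m, n), sylvester A B Y = C -> Y = X) &
        (fun N : nat => (\sum_(0 <= j < N)
           series_coef (interval_union beta gamma) w p j *: P j
             : 'M[R[i]^o]_(m, n)))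
          @ \oo --> (X : 'M[R[i]^o]_(m, n))].
Proof.
move=> [V Vu /diagonalizable_forPex[da /(simmxP Vu) VA]].
move=> [W Wu /diagonalizable_forPex[db /(simmxP Wu) WB]] _ _ S0 spec hw op rc rS.
set S := interval_union beta gamma in S0 spec hw op *.
have mS : measurable S := measurable_interval_union _ _.
have iw := admissible_weight_integrable hw.
have [M SM] := interval_union_bounded beta gamma.
have Saway := interval_union_away0 S0.
have w0 x (_ : S x) : 0 <= w x := weight_ge0 hw x.
have w1 : weighted_int S w (fun=> 1) = 1.
  rewrite -[RHS](weight_int hw); apply: eq_Rintegral => x _; by rewrite mul1r.
have p0 := orthonormal_polys_0 mS iw w1 op.
pose L (Z : 'M[R[i]]_(m, n)) := invmx W *m Z *m V.
have LK Z : L (W *m Z *m invmx V) = Z.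
  by rewrite /L !mulmxA mulVmx// mul1mx -mulmxA mulVmx// mulmx1.
have KL Z : W *m L Z *m invmx V = Z.
  by rewrite /L !mulmxA mulmxV// mul1mx -mulmxA mulmxV// mulmx1.
have SL Z : sylvester A B (L Z) = L (\matrix_(i, j) ((da 0 j - db 0 i) * Z i j)).
  exact: sylvester_conj.
(* The matrix units are, in these coordinates, eigenvectors of the operator. *)
have ev i j : exists2 x, interior S x & x%:C = da 0 j - db 0 i.
  apply: spec; apply: (@sylvester_spectrumP _ _ _ _ _ _ (L (delta_mx i j))).
    apply/eqP => h; have := KL (delta_mx i j); rewrite h mulmx0 mul0mx.
    by move=> /matrixP/(_ i j)/eqP; rewrite !mxE !eqxx eq_sym oner_eq0.
  rewrite SL /L scalemxAl scalemxAr; congr (_ *m _ *m _).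
  apply/matrixP => k l; rewrite !mxE.
  by case: eqVneq => [->|_]; case: eqVneq => [->|_]; rewrite ?mulr0.
pose x i j := complex.Re (da 0 j - db 0 i).
have hx i j : da 0 j - db 0 i = (x i j)%:C.
  by have [y _ yE] := ev i j; rewrite /x -yE.
have ix i j : interior S (x i j).
  by have [y yS yE] := ev i j; rewrite /x -yE.
have x0 i j : x i j != 0.
  by apply: contra_notN S0 => /eqP <-; exact: interior_subset (ix i j).
pose C' := W *m C *m invmx V.
have PE := sylvester_recurrence_horner (C' := C') Wu VA WB hx p0 rc.
have {PE} PE k : P k = L (\matrix_(i, j) ((p k).[x i j]%:C * C' i j)).
  by apply: PE; rewrite -/(L C') LK.
exists (L (\matrix_(i, j) ((x i j)^-1%:C * C' i j))); split.
- rewrite SL -[RHS]LK; congr L; apply/matrixP => i j; rewrite !mxE hx mulrA.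
  by rewrite -rmorphM mulfV// rmorph1 mul1r.
- move=> Y; rewrite -(LK Y) SL => h; congr L.
  apply/matrixP => i j; rewrite [RHS]mxE.
  have := KL (\matrix_(i, j) ((da 0 j - db 0 i) * (W *m Y *m invmx V) i j)).
  rewrite h -/C' => ->.
  by rewrite [X in _ = _ * X]mxE hx mulrA -rmorphM mulVf// rmorph1 mul1r.
have sumE N : \sum_(0 <= k < N) series_coef S w p k *: P k =
   L (\matrix_(i, j) ((\sum_(k < N)
     weighted_int S w (fun y => y^-1 * (p k).[y]) * (p k).[x i j])%:C * C' i j)).
  rewrite big_mkord.
  rewrite /L; under eq_bigr do rewrite series_coefE PE /L scalemxAl scalemxAr.
  rewrite -mulmx_suml -mulmx_sumr; congr (_ *m _ *m _).
  apply/matrixP => i j; rewrite summxE !mxE rmorph_sum mulr_suml.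
  by apply: eq_bigr => k _; rewrite !mxE rmorphM mulrA.
under eq_fun do rewrite sumE.
apply: cvg_mulmx_real => i j.
have [c [d [c0 d0 dS wc]]] := admissible_weight_local hw (ix i j).
exact: (fourier_inv_cvg mS w0 iw SM op w1 Saway c0 d0 dS wc).
Qed.
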